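(* For all $n\ge2$, we have $c_n(132,312)=4\cdot 3^{n-2}$.
   Context: A word $\pi=\pi_1\dots\pi_m$ over the positive integers contains the pattern $\sigma=\sigma_1\dots\sigma_k$ if there are indices $1\le i_1<\dots<i_k\le m$ such that for all $r,s\in\{1,\dots,k\}$: $\pi_{i_r}<\pi_{i_s}$ iff $\sigma_r<\sigma_s$, and $\pi_{i_r}=\pi_{i_s}$ iff $\sigma_r=\sigma_s$; otherwise $\pi$ avoids $\sigma$. $\mathcal{C}_n$ denotes the set of nonnesting permutations: arrangements (words) of the multiset $\{1,1,2,2,\dots,n,n\}$ that avoid the patterns $1221$ and $2112$. For patterns $\sigma,\tau,\dots$, $c_n(\sigma,\tau,\dots)$ is the number of $\pi\in\mathcal{C}_n$ avoiding all of $\sigma,\tau,\dots$. *)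

(* Defs.v *)
From mathcomp Require Import all_boot.

Set Implicit Arguments.
Unset Strict Implicit.
Unset Printing Implicit Defensive.

Definition contains (sigma pi : seq nat) : bool :=
  [exists i : {ffun 'I_(size sigma) -> 'I_(size pi)},
    [forall r : 'I_(size sigma), forall s : 'I_(size sigma), (r < s) ==> (i r < i s)] &&
    [forall r : 'I_(size sigma), forall s : 'I_(size sigma),
      ((nth 0 pi (i r) < nth 0 pi (i s)) == (nth 0 sigma r < nth 0 sigma s)) &&
      ((nth 0 pi (i r) == nth 0 pi (i s)) == (nth 0 sigma r == nth 0 sigma s))]].

Definition avoids (sigma pi : seq nat) : bool := ~~ contains sigma pi.

Definition double_word (n : nat) : seq nat :=
  flatten [seq [:: k; k] | k <- iota 1 n].

(* [permutations s] is duplicate-free even when [s] has repeated letters, so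
   each nonnesting permutation is listed exactly once. *)
Definition nonnesting (n : nat) : seq (seq nat) :=
  [seq pi <- permutations (double_word n)
     | avoids [:: 1; 2; 2; 1] pi && avoids [:: 2; 1; 1; 2] pi].

Definition c (n : nat) (patterns : seq (seq nat)) : nat :=
  count (fun pi => all (fun sigma => avoids sigma pi) patterns) (nonnesting n).

(* Main.v *)
Require Import Defs.
From mathcomp Require Import all_boot zify.

(** Avoiding 132 and 312 means that no letter lies strictly between two letters
    preceding it: read from left to right, every letter is weakly a running
    maximum or a running minimum. In particular the last letter of a
    nonnesting permutation of size [n] with this property is [1] or [n]
    ([admissible_last]), and complementing the values exchanges the two cases
    ([ending_count_max]). Hence, for [n >= 2], the admissible words number
    twice those ending in [n], and it suffices to count the latter.

    Let [N = n + 1], with [n >= 1], and remove both copies of [N] from an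
    admissible word [p N q N]. A letter [x] of [q] has [N] before it, so it
    must be a running minimum. If [x <> 1] then both copies of [1] are in [q],
    and [N 1 1 N] is nested; so [q] consists of copies of [1], and for the same
    reason it has at most one ([admissible_ending_max_inv]). Conversely, [N N]
    can be appended to any admissible word of size [n], and the last letter [1]
    of an admissible word can be surrounded by two [N]
    ([admissible_append], [admissible_insert]). Therefore the words of size [N]
    ending in [N] are in bijection with all those of size [n] together with
    those ending in [1] ([ending_count_rec]). For [n >= 2] this triples the
    number of words ending in the maximum, which is 2 for [n = 2]. *)

(** * Pattern containment through subsequences *)

(** An increasing list of indices is the list of positions filtered by
    membership in it, so reading the letters there yields a subsequence. *)
Lemma nth_map_subseq (js pi : seq nat) :
  sorted ltn js -> all (gtn (size pi)) js ->
  subseq [seq nth 0 pi j | j <- js] pi.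
Proof.
move=> js_incr js_lt.
have -> : js = [seq j <- iota 0 (size pi) | j \in js].
  apply: (irr_sorted_eq ltn_trans ltnn) => //.
    by rewrite sorted_filter ?iota_ltn_sorted //; apply: ltn_trans.
  move=> j; rewrite mem_filter mem_iota add0n leq0n andTb.
  by case: (boolP (j \in js)) => // /(allP js_lt).
rewrite -[X in subseq _ X](take_size pi) -(map_nth_iota0 0 (leqnn _)).
exact/map_subseq/filter_subseq.
Qed.

Definition order_isomorphic (t sigma : seq nat) : Prop :=
  size t = size sigma /\
  forall r s, r < size sigma -> s < size sigma ->
    ((nth 0 t r < nth 0 t s) = (nth 0 sigma r < nth 0 sigma s)) /\
    ((nth 0 t r == nth 0 t s) = (nth 0 sigma r == nth 0 sigma s)).

(** With [subseq] in place of embeddings of index types, avoidance passes to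
    subwords by transitivity, and can be tested by peeling off last letters. *)
Lemma containsP (sigma pi : seq nat) :
  reflect (exists2 t, subseq t pi & order_isomorphic t sigma) (contains sigma pi).
Proof.
apply: (iffP existsP) => [[i /andP[/'forall_forallP i_incr /'forall_forallP i_iso]]|].
  exists [seq nth 0 pi (i r) | r <- enum 'I_(size sigma)].
    rewrite (map_comp (nth 0 pi) (fun r => nat_of_ord (i r))).
    apply: nth_map_subseq; last by apply/allP => j /mapP[r _ ->] /=.
    rewrite sorted_map.
    have : sorted ltn (map val (enum 'I_(size sigma))).
      by rewrite val_enum_ord iota_ltn_sorted.
    rewrite sorted_map; apply: sub_sorted => r s /= lt_rs.
    by move: (i_incr r s); rewrite lt_rs.
  split=> [|r s lt_r lt_s]; first by rewrite size_map size_enum_ord.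
  have ordE k (lt_k : k < size sigma) :
      nth 0 [seq nth 0 pi (i r0) | r0 <- enum 'I_(size sigma)] k
      = nth 0 pi (i (Ordinal lt_k)).
    rewrite (nth_map (Ordinal lt_k)) ?size_enum_ord //.
    by rewrite (nth_ord_enum _ (Ordinal lt_k)).
  rewrite !ordE.
  by have /andP[/eqP-> /eqP->] := i_iso (Ordinal lt_r) (Ordinal lt_s).
case=> t /subseqP[m size_m def_t] [size_t t_iso].
pose js := mask m (iota 0 (size pi)).
have def_js : t = [seq nth 0 pi j | j <- js].
  by rewrite map_mask map_nth_iota0 // take_size.
have js_incr : sorted ltn js.
  by rewrite sorted_mask ?iota_ltn_sorted //; apply: ltn_trans.
have size_js : size js = size sigma by rewrite -size_t def_js size_map.
have js_lt (r : 'I_(size sigma)) : nth 0 js r < size pi.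
  have /mem_mask : nth 0 js r \in js by rewrite mem_nth // size_js.
  by rewrite mem_iota add0n.
exists [ffun r => Ordinal (js_lt r)]; apply/andP; split.
  apply/'forall_forallP => r s; apply/implyP => lt_rs; rewrite !ffunE /=.
  by apply: (sorted_ltn_nth ltn_trans) => //; rewrite inE size_js.
apply/'forall_forallP => r s; rewrite !ffunE /=.
have [] := t_iso r s (ltn_ord r) (ltn_ord s).
by rewrite def_js !(nth_map 0) ?size_js // => -> ->; rewrite !eqxx.
Qed.

(** * The two avoidance conditions *)

Definition nonnested (w : seq nat) : Prop :=
  forall a b, a != b -> ~~ subseq [:: a; b; b; a] w.

(** The name refers to an equivalent condition: every letter is weakly above
    all the letters before it, or weakly below all of them. *)
Definition extremal (w : seq nat) : Prop :=
  forall a b c, a < b < c ->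
    ~~ subseq [:: a; c; b] w && ~~ subseq [:: c; a; b] w.

Lemma nonnestedP (w : seq nat) :
  reflect (nonnested w)
    (avoids [:: 1; 2; 2; 1] w && avoids [:: 2; 1; 1; 2] w).
Proof.
rewrite /avoids -negb_or; apply: (iffP idP) => [avoid_w a b neq_ab|nn_w].
  apply: contra avoid_w => sub_w.
  have [lt_ab|lt_ba] : a < b \/ b < a by lia.
    apply/orP; left; apply/containsP; exists [:: a; b; b; a] => //.
    by split=> // [[|[|[|[|r]]]] [|[|[|[|s]]]]] //=; lia.
  apply/orP; right; apply/containsP; exists [:: a; b; b; a] => //.
  by split=> // [[|[|[|[|r]]]] [|[|[|[|s]]]]] //=; lia.
apply/negP => /orP[] /containsP[t sub_w [size_t iso]];
  case: t size_t sub_w iso => [|a [|b [|b' [|a' []]]]] // _ sub_w iso;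
  have := (iso 0 1 isT isT, iso 0 3 isT isT, iso 1 2 isT isT);
  rewrite /= => -[[[_ neq_ab] [_ /eqP eq_a]] [_ /eqP eq_b]];
  by move: (nn_w a b); rewrite neq_ab {2}eq_b {2}eq_a sub_w => /(_ isT).
Qed.

Lemma extremalP (w : seq nat) :
  reflect (extremal w)
    (all (fun sigma => avoids sigma w) [:: [:: 1; 3; 2]; [:: 3; 1; 2]]).
Proof.
rewrite /= andbT; apply: (iffP andP) => [[av132 av312] a b c lt_abc|ext_w].
  apply/andP; split; [apply: contra av132 | apply: contra av312] => sub_w.
    apply/containsP; exists [:: a; c; b] => //.
    by split=> // [[|[|[|r]]] [|[|[|s]]]] //=; lia.
  apply/containsP; exists [:: c; a; b] => //.
  by split=> // [[|[|[|r]]] [|[|[|s]]]] //=; lia.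
split; apply/negP => /containsP[t sub_w [size_t iso]];
  case: t size_t sub_w iso => [|x [|y [|b []]]] // _ sub_w iso;
  have := (iso 0 2 isT isT, iso 2 1 isT isT, iso 2 0 isT isT, iso 1 2 isT isT);
  rewrite /= => -[[[[xb _] [bY _]] [bx _]] [yb _]].
  by have := ext_w x b y; rewrite xb bY sub_w => /(_ isT).
by have := ext_w y b x; rewrite yb bx sub_w andbF => /(_ isT).
Qed.

Lemma nonnested_subseq (v w : seq nat) :
  subseq v w -> nonnested w -> nonnested v.
Proof.
move=> sub_vw nn_w a b /nn_w; apply: contra => /subseq_trans; exact.
Qed.

Lemma extremal_subseq (v w : seq nat) :
  subseq v w -> extremal w -> extremal v.
Proof.
move=> sub_vw ext_w a b c /ext_w/andP[no_acb no_cab]; apply/andP.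
by split; [apply: contra no_acb | apply: contra no_cab] => /subseq_trans; exact.
Qed.

Lemma subseq_rcons2 (T : eqType) (s w : seq T) (x y : T) :
  subseq (rcons s x) (rcons w y) = subseq (if x == y then s else rcons s x) w.
Proof.
by rewrite -subseq_rev !rev_rcons /=; case: eqP => _;
  rewrite -?rev_rcons subseq_rev.
Qed.

(** A new nesting would use the new letter as its outer right one. *)
Lemma nonnested_rcons (w : seq nat) (x : nat) :
  nonnested w -> (forall b, x != b -> ~~ subseq [:: x; b; b] w) ->
  nonnested (rcons w x).
Proof.
move=> nn_w no_xbb a b neq_ab.
rewrite (subseq_rcons2 _ [:: a; b; b]).
by case: (a =P x) neq_ab => [->|_]; [exact: no_xbb | exact: nn_w].
Qed.

(** A new occurrence of 132 or 312 would use the new letter as its last one,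
    strictly between two earlier letters. *)
Lemma extremal_rcons (w : seq nat) (x : nat) :
  extremal w -> all (geq x) w || all (leq x) w -> extremal (rcons w x).
Proof.
move=> ext_w bound_x a b c lt_abc.
rewrite (subseq_rcons2 _ [:: a; c]) (subseq_rcons2 _ [:: c; a]).
case: eqP => [eq_bx|_]; last exact: ext_w.
have notboth : ~~ ((a \in w) && (c \in w)).
  apply/negP => /andP[aw cw].
  by case/orP: bound_x => /allP bw; [have := bw c cw | have := bw a aw] => /=; lia.
by apply/andP; split; apply: contra notboth => /mem_subseq sub;
  rewrite !sub // !inE eqxx ?orbT.
Qed.

(** * Admissible words *)

Definition admissible (n : nat) (w : seq nat) : Prop :=
  [/\ perm_eq w (double_word n), nonnested w & extremal w].

Definition admissible_words (n : nat) : seq (seq nat) :=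
  [seq w <- nonnesting n |
     all (fun sigma => avoids sigma w) [:: [:: 1; 3; 2]; [:: 3; 1; 2]]].

Lemma admissible_wordsP (n : nat) (w : seq nat) :
  reflect (admissible n w) (w \in admissible_words n).
Proof.
rewrite !mem_filter mem_permutations.
apply: (iffP and3P) => [[/extremalP ? /nonnestedP ?]|[? /nonnestedP ? /extremalP ?]];
  by split.
Qed.

Lemma admissible_words_uniq (n : nat) : uniq (admissible_words n).
Proof. by rewrite !filter_uniq ?permutations_uniq. Qed.

Lemma count_double_word (n k : nat) :
  count_mem k (double_word n) = (0 < k <= n).*2.
Proof.
have -> : count_mem k (double_word n) = (count_mem k (iota 1 n)).*2.
  by rewrite /double_word; elim: (iota 1 n) => //= x s ->; lia.
by rewrite count_uniq_mem ?iota_uniq // mem_iota; congr (nat_of_bool _).*2; lia.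
Qed.

Lemma mem_double_word (n k : nat) : (k \in double_word n) = (0 < k <= n).
Proof. by rewrite -has_pred1 has_count count_double_word; case: (0 < k <= n). Qed.

Lemma double_wordS (n : nat) :
  double_word n.+1 = double_word n ++ [:: n.+1; n.+1].
Proof. by rewrite /double_word -{1}[n.+1]addn1 iotaD map_cat flatten_cat /= add1n. Qed.

Lemma mem_admissible (n k : nat) (w : seq nat) :
  admissible n w -> (k \in w) = (0 < k <= n).
Proof. by case=> /perm_mem-> _ _; apply: mem_double_word. Qed.

(** * The complement symmetry *)

Lemma subseq_map_inv (T U : eqType) (f : T -> U) (s : seq U) (w : seq T) :
  subseq s (map f w) -> exists2 t, subseq t w & s = map f t.
Proof.
case/subseqP=> m _ ->; exists (mask m w); first exact: mask_subseq.
by rewrite map_mask.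
Qed.

Definition complement (n : nat) (w : seq nat) : seq nat :=
  [seq n.+1 - k | k <- w].

Lemma complementK (n : nat) (w : seq nat) :
  {in w, forall k, k <= n} -> complement n (complement n w) = w.
Proof.
by move=> le_wn; rewrite /complement -map_comp map_id_in // => k /le_wn /=; lia.
Qed.

(** Complementation reverses the order of the letters, so it exchanges the
    patterns 132 and 312, and likewise 1221 and 2112. *)
Lemma admissible_complement (n : nat) (w : seq nat) :
  admissible n w -> admissible n (complement n w).
Proof.
move=> adm_w; have mem_w := fun k => mem_admissible n k w adm_w.
have le_wn : {in w, forall k, k <= n} by move=> k; rewrite mem_w; lia.
case: adm_w => perm_w nn_w ext_w; split.
- rewrite /complement (perm_trans (perm_map _ perm_w)) //.
  apply/allP => k _ /=; apply/eqP; rewrite count_map.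
  case: (boolP (0 < k <= n)) => [in_k|out_k].
    rewrite (@eq_in_count _ _ (pred1 (n.+1 - k))) => [|j].
      by rewrite !count_double_word; congr (nat_of_bool _).*2; lia.
    by rewrite mem_double_word /=; lia.
  rewrite count_double_word (negbTE out_k) (@eq_in_count _ _ pred0) ?count_pred0 //.
  by move=> j; rewrite mem_double_word /=; lia.
- move=> a b neq_ab; apply/negP => /subseq_map_inv[].
  move=> [|a1 [|b1 [|b2 [|a2 []]]]] // sub [def_a def_b eq_b eq_a].
  have le_s : all (geq n) [:: a1; b1; b2; a2].
    by apply/allP => k /(mem_subseq sub)/le_wn.
  have [eq_a12 eq_b12] : a2 = a1 /\ b2 = b1 by move: le_s => /=; lia.
  by move: (nn_w a1 b1); rewrite -{3}eq_a12 -{3}eq_b12 sub; lia.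
move=> a b c lt_abc; apply/andP.
split; apply/negP => /subseq_map_inv[] [|x [|y [|z []]]] // sub [def_x def_y def_z].
  have := ext_w y z x; rewrite sub andbF; lia.
have := ext_w x z y; rewrite sub; lia.
Qed.

Lemma perm_complement_admissible (n : nat) :
  perm_eq [seq complement n w | w <- admissible_words n] (admissible_words n).
Proof.
have complementK_in : {in admissible_words n, cancel (complement n) (complement n)}.
  move=> w /admissible_wordsP adm_w; apply: complementK => k.
  by rewrite (mem_admissible _ _ _ adm_w); lia.
apply: uniq_perm; rewrite ?admissible_words_uniq //.
  rewrite map_inj_in_uniq ?admissible_words_uniq //.
  exact: can_in_inj complementK_in.
move=> w; apply/mapP/idP => [[v /admissible_wordsP adm_v ->]|w_in].
  exact/admissible_wordsP/admissible_complement.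
exists (complement n w); last by rewrite complementK_in.
by apply/admissible_wordsP/admissible_complement/admissible_wordsP.
Qed.

Definition ending_count (n x : nat) : nat :=
  count (fun w => last 0 w == x) (admissible_words n).

Lemma ending_count_max (n : nat) : 0 < n -> ending_count n n = ending_count n 1.
Proof.
move=> n_gt0; rewrite /ending_count -(permP (perm_complement_admissible n)).
rewrite count_map; apply: eq_in_count => w /admissible_wordsP adm_w /=.
have mem_w := fun k => mem_admissible n k w adm_w.
case/lastP: w adm_w mem_w => [_ /(_ 1)|w x _ /(_ x)]; first by rewrite n_gt0.
by rewrite mem_rcons mem_head /complement map_rcons !last_rcons; lia.
Qed.

(** * The last letter *)

Lemma mem2_subseq (T : eqType) (x y : T) (w : seq T) :
  x \in w -> y \in w -> x != y -> subseq [:: x; y] w || subseq [:: y; x] w.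
Proof.
move=> xw yw neq_xy; case/splitPr: xw yw => p q; rewrite mem_cat inE eq_sym.
rewrite (negbTE neq_xy) /= => /orP[yp|yq]; apply/orP; [right|left].
  by rewrite (@cat_subseq _ [:: y] [:: x] p) ?sub1seq // mem_head.
by rewrite (@cat_subseq _ [::] [:: x; y] p) ?sub0seq //= eqxx sub1seq.
Qed.

(** A last letter other than [1] and [n] would lie strictly between these two
    letters, both of which precede it. *)
Lemma admissible_last (n : nat) (w : seq nat) :
  0 < n -> admissible n w -> (last 0 w == 1) || (last 0 w == n).
Proof.
move=> n_gt0 adm_w; have mem_w := fun k => mem_admissible n k w adm_w.
case: adm_w => _ _; case/lastP: w mem_w => [/(_ 1)|w x mem_w ext_w].
  by rewrite n_gt0.
rewrite last_rcons -[_ || _]negbK negb_or; apply/negP => /andP[x_neq1 x_neqn].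
have := mem_w x; rewrite mem_rcons mem_head => x_in.
have := mem_w 1; have := mem_w n; rewrite !mem_rcons !inE.
rewrite ![_ == x]eq_sym (negbTE x_neq1) (negbTE x_neqn) /= => n_in one_in.
have lt_1xn : 1 < x < n by lia.
have /andP[] := ext_w _ _ _ lt_1xn.
rewrite (subseq_rcons2 _ [:: 1; n]) (subseq_rcons2 _ [:: n; 1]) eqxx.
have := @mem2_subseq _ 1 n w; case: subseq => //; case: subseq => // mem2 _ _.
by move: mem2; rewrite one_in n_in; lia.
Qed.

(** The hypothesis [1 < n] makes the endings [1] and [n] exclusive. *)
Lemma size_admissible_words (n : nat) :
  1 < n -> size (admissible_words n) = (ending_count n n).*2.
Proof.
move=> n_gt1; rewrite -addnn {2}ending_count_max ?(ltnW n_gt1) //.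
rewrite -(count_predC (fun w => last 0 w == n)); congr (_ + _).
apply: eq_in_count => w /admissible_wordsP adm_w /=.
by have := admissible_last n w (ltnW n_gt1) adm_w; lia.
Qed.

(** * Inserting a new maximum *)

Definition insert_around_last (N : nat) (w : seq nat) : seq nat :=
  take (size w).-1 w ++ [:: N; last 0 w; N].

Lemma insert_around_last_rcons (N : nat) (w : seq nat) (x : nat) :
  insert_around_last N (rcons w x) = w ++ [:: N; x; N].
Proof.
by rewrite /insert_around_last size_rcons last_rcons -cats1 take_size_cat.
Qed.

Lemma admissible_append (n : nat) (w : seq nat) :
  admissible n w -> admissible n.+1 (w ++ [:: n.+1; n.+1]).
Proof.
move=> adm_w; have mem_w := fun k => mem_admissible n k w adm_w.
have notin_w : n.+1 \notin w by rewrite mem_w; lia.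
case: adm_w => perm_w nn_w ext_w.
split; first by rewrite double_wordS perm_cat2r.
all: rewrite -cat_rcons cats1.
- apply: nonnested_rcons => [|b neq_b]; first apply: nonnested_rcons => // b neq_b.
    by apply: contra notin_w => /mem_subseq-> //; rewrite mem_head.
  rewrite (subseq_rcons2 _ [:: n.+1; b]) eq_sym (negbTE neq_b).
  by apply: contra notin_w => /mem_subseq-> //; rewrite mem_head.
- have le_w : all (geq n.+1) w by apply/allP => k; rewrite mem_w /=; lia.
  by do 2?apply: extremal_rcons; rewrite ?all_rcons ?le_w //= leqnn.
Qed.

(** The new maximum opens after every first occurrence and closes after the
    second [1], so nothing nests; the letter [1] after it is a minimum. *)
Lemma admissible_insert (n : nat) (w : seq nat) :
  0 < n -> admissible n (rcons w 1) -> admissible n.+1 (w ++ [:: n.+1; 1; n.+1]).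
Proof.
move=> n_gt0 adm_w; have mem_w := fun k => mem_admissible n k (rcons w 1) adm_w.
have [notin_w ge_w le_w] :
    [/\ n.+1 \notin w, all (leq 1) w & all (geq n.+1) w].
  have mem_w1 k : k \in w -> 0 < k <= n.
    by move=> kw; rewrite -mem_w mem_rcons inE kw orbT.
  by split; [apply/negP=> /mem_w1|apply/allP=> k /mem_w1 /=|apply/allP=> k /mem_w1 /=]; lia.
case: adm_w => perm_w nn_w1 ext_w1.
have [nn_w ext_w] : nonnested w /\ extremal w.
  split; [move: nn_w1; apply: nonnested_subseq | move: ext_w1; apply: extremal_subseq].
    exact: subseq_rcons.
  exact: subseq_rcons.
split.
- rewrite double_wordS; apply: perm_trans (_ : perm_eq (rcons w 1 ++ [:: n.+1; n.+1]) _).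
    by rewrite cat_rcons perm_cat2l (perm_catCA [:: n.+1] [:: 1]).
  by rewrite perm_cat2r.
all: rewrite -!cat_rcons cats0.
- apply: nonnested_rcons => [|b neq_b]; first apply: nonnested_rcons => [|b neq_b].
  + apply: nonnested_rcons => // b neq_b.
    by apply: contra notin_w => /mem_subseq-> //; rewrite mem_head.
  + rewrite (subseq_rcons2 _ [:: 1; b]); case: eqP => [->|_].
      by apply: contra notin_w => /mem_subseq-> //; rewrite !inE eqxx orbT.
    have := nn_w1 1 b neq_b; rewrite (subseq_rcons2 _ [:: 1; b; b]) eqxx.
    exact.
  + rewrite (subseq_rcons2 _ [:: n.+1; b]); case: eqP => _.
      rewrite (subseq_rcons2 _ [:: n.+1]) eq_sym (negbTE neq_b).
      by apply: contra notin_w => /mem_subseq-> //; rewrite mem_head.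
    rewrite (subseq_rcons2 _ [:: n.+1; b]) eq_sym (negbTE neq_b).
    by apply: contra notin_w => /mem_subseq-> //; rewrite mem_head.
- by do 3?apply: extremal_rcons; rewrite ?all_rcons ?le_w ?ge_w //= ?leqnn ?orbT.
Qed.

(** The letters between the two copies of the maximum form the empty word or
    the single letter [1], so erasing the maximum inverts one of the two
    insertions. *)
Lemma admissible_ending_max_inv (n : nat) (v : seq nat) :
  0 < n -> admissible n.+1 (rcons v n.+1) ->
  exists2 w, admissible n w &
    rcons v n.+1 = w ++ [:: n.+1; n.+1] \/
    (last 0 w == 1) && (rcons v n.+1 == insert_around_last n.+1 w).
Proof.
move=> n_gt0 [perm_v nn_v ext_v].
have N_in : n.+1 \in v.
  have := permP perm_v (pred1 n.+1).
  rewrite count_double_word ltnSn -cats1 count_cat /= eqxx -has_pred1 has_count.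
  by case: count.
case/splitPr: N_in perm_v nn_v ext_v => p q perm_v nn_v ext_v.
have perm_pq : perm_eq (p ++ q) (double_word n).
  rewrite -(perm_cat2r [:: n.+1; n.+1]) -double_wordS.
  apply: perm_trans perm_v.
  by rewrite rcons_cat -cats1 -catA perm_cat2l (perm_catCA q [:: _] [:: _]).
have mem_pq k : (k \in p ++ q) = (0 < k <= n).
  by rewrite (perm_mem perm_pq) mem_double_word.
have sub_pq : subseq (p ++ q) (rcons (p ++ n.+1 :: q) n.+1).
  apply: subseq_trans (subseq_rcons _ _); rewrite cat_subseq // subseq_cons //.
have q_all1 : all (pred1 1) q.
  apply/allP => x xq; apply/negPn/negP => /= x_neq1.
  have lt_1xn : 1 < x < n.+1.
    by have := mem_pq x; rewrite mem_cat xq orbT; lia.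
  (* A [1] before the first [n.+1] would form a 132 with it and [x]. *)
  have notin_p : 1 \notin p.
    apply/negP => one_p; have /andP[/negP no_1Nx _] := ext_v _ _ _ lt_1xn.
    apply: no_1Nx; apply: subseq_trans (subseq_rcons _ _).
    by rewrite (@cat_subseq _ [:: 1] [:: n.+1; x] p) ?sub1seq //= eqxx sub1seq.
  (* So both copies of [1] are in [q], nested between the copies of [n.+1]. *)
  have := nn_v n.+1 1; rewrite -cats1 -catA.
  have /= sub_q : subseq (nseq 2 1) q.
    have <- : count_mem 1 q = 2.
      have := permP perm_pq (pred1 1); rewrite count_cat count_double_word n_gt0.
      by rewrite (count_memPn notin_p).
    by rewrite -size_filter -(all_pred1P _ _ (filter_all (pred1 1) q)) filter_subseq.
  rewrite (@cat_subseq _ [::] [:: n.+1; 1; 1; n.+1] p) ?sub0seq //=; last first.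
    by rewrite eqxx (@cat_subseq _ [:: 1; 1] [:: n.+1] q) //= eqxx.
  by lia.
have def_q : q = nseq (size q) 1 by apply/all_pred1P.
have adm_pq : admissible n (p ++ q).
  by split=> //; [move: nn_v; apply: nonnested_subseq
                 | move: ext_v; apply: extremal_subseq].
have q_short : q = [::] \/ q = [:: 1].
  case: (size q) def_q => [|[|k]] def_q; [by left|by right|].
  have := nn_v n.+1 1; rewrite def_q -cats1 -catA.
  rewrite (@cat_subseq _ [::] [:: n.+1; 1; 1; n.+1] p) ?sub0seq //= ?eqxx; last first.
    by rewrite sub1seq mem_cat mem_head orbT.
  by lia.
exists (p ++ q) => //; case: q_short => ->; [left|right].
  by rewrite cats0 -cats1 -catA.
by rewrite cats1 insert_around_last_rcons last_rcons rcons_cat !eqxx.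
Qed.

(** The two families on the right are disjoint because their words have
    different penultimate letters, [n.+1] and [1]. *)
Lemma perm_ending_max (n : nat) : 0 < n ->
  perm_eq [seq v <- admissible_words n.+1 | last 0 v == n.+1]
    ([seq w ++ [:: n.+1; n.+1] | w <- admissible_words n] ++
     [seq insert_around_last n.+1 w | w <- admissible_words n & last 0 w == 1]).
Proof.
move=> n_gt0; apply: uniq_perm; first by rewrite filter_uniq ?admissible_words_uniq.
  have last_rconsE w : w \in [seq w <- admissible_words n | last 0 w == 1] ->
      exists u, w = rcons u 1.
    rewrite mem_filter; case/lastP: w => // u x.
    by rewrite last_rcons => /andP[/eqP-> _]; exists u.
  rewrite cat_uniq; apply/and3P; split.
  - rewrite map_inj_uniq ?admissible_words_uniq // => w w'.
    by rewrite -!cat_rcons !cats0 => /rcons_inj[/rcons_inj[]].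
  - apply/hasPn => _ /mapP[_ /last_rconsE[u ->] ->]; apply/mapP => -[w _].
    rewrite insert_around_last_rcons -!cat_rcons !cats0.
    by move=> /rcons_inj[/rcons_inj[_]]; lia.
  - rewrite map_inj_in_uniq; first exact/filter_uniq/admissible_words_uniq.
    move=> _ _ /last_rconsE[u ->] /last_rconsE[u' ->].
    rewrite !insert_around_last_rcons -!cat_rcons !cats0.
    by move=> /rcons_inj[/rcons_inj[/rcons_inj[->]]].
move=> v; rewrite mem_filter mem_cat; apply/andP/orP.
  case/lastP: v => [[]|v x]; first by [].
  rewrite last_rcons => -[/eqP-> /admissible_wordsP].
  case/(admissible_ending_max_inv n v n_gt0) => w /admissible_wordsP w_in [->|].
    by left; apply: map_f.
  by case/andP=> w_last /eqP->; right; rewrite map_f // mem_filter w_last.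
case=> /mapP[w].
  by move=> /admissible_wordsP/admissible_append/admissible_wordsP v_in ->;
    rewrite last_cat.
rewrite mem_filter; case/lastP: w => // w x; rewrite last_rcons.
case/andP=> /eqP-> /admissible_wordsP/(admissible_insert _ _ n_gt0)/admissible_wordsP.
by move=> v_in ->; rewrite insert_around_last_rcons last_cat.
Qed.

(** * Counting *)

Lemma ending_count_rec (n : nat) : 0 < n ->
  ending_count n.+1 n.+1 = size (admissible_words n) + ending_count n 1.
Proof.
move=> n_gt0; rewrite /ending_count -size_filter (perm_size (perm_ending_max n n_gt0)).
by rewrite size_cat !size_map size_filter.
Qed.

Lemma perm_admissible_words1 : perm_eq (admissible_words 1) [:: [:: 1; 1]].
Proof.
apply: uniq_perm; rewrite ?admissible_words_uniq // => w; rewrite inE.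
apply/admissible_wordsP/eqP => [[perm_w _ _]|->].
  have /all_pred1P-> : all (pred1 1) w by rewrite (perm_all _ perm_w).
  by rewrite (perm_size perm_w).
by apply: (admissible_append 0 [::]); split=> // ? *.
Qed.

Theorem theorem2p8 (n : nat) (hn : 2 <= n) :
  c n [:: [:: 1; 3; 2]; [:: 3; 1; 2]] = 4 * 3 ^ (n - 2).
Proof.
have -> : c n [:: [:: 1; 3; 2]; [:: 3; 1; 2]] = size (admissible_words n).
  by rewrite size_filter.
rewrite size_admissible_words //; case: n hn => [|[|m]] // _; rewrite subn2 /=.
suff -> : ending_count m.+2 m.+2 = 2 * 3 ^ m by lia.
elim: m => [|m IHm].
  rewrite ending_count_rec // (perm_size perm_admissible_words1) /ending_count.
  by rewrite (permP perm_admissible_words1).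
by rewrite ending_count_rec // size_admissible_words // -ending_count_max // IHm expnS; lia.
Qed.
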